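(* Let $0<q<1$ and $L\in GL_m(\mathbb C)$. The following are equivalent: (i) $L\Gamma_qL^{-1}=\Gamma_q$; (ii) conjugation by $L$ permutes the set $\{T_1,\dots,T_m\}$; (iii) $L$ is a monomial matrix, that is, a product of an invertible diagonal matrix and a permutation matrix. Consequently, the maximal unitary subgroup normalizing the coordinate-dilation group $\Gamma_q$ is $U(1)^m\rtimes\mathfrak S_m$, not $U(m)$ when $m\ge2$. The paired $(z,w)$ grid has the corresponding Hermitian action $z\mapsto Lz$, $w\mapsto\overline Lw$ for monomial unitary $L$.
   Context: $T_i\in GL_m(\mathbb C)$ is the linear dilation which multiplies the $i$-th coordinate by $q$ and fixes the remaining coordinates, and $\Gamma_q:=\langle T_1,\dots,T_m\rangle=\{\operatorname{diag}(q^{k_1},\dots,q^{k_m}):k\in\mathbb Z^m\}$ is called the coordinate-dilation group of the $z$-lattice. $\mathfrak S_m$ is the symmetric group, realized by permutation matrices; $U(1)^m$ is realized by diagonal unitary matrices; $\overline L$ is the entrywise complex conjugate of $L$. The variables $z=(z_1,\dots,z_m)$ and $w=(w_1,\dots,w_m)$ are two independent sets of complex coordinates ($w$ playing the role of the conjugate polarization of $z$), and the paired $(z,w)$ grid refers to the multiplicative $q$-lattice $\Lambda_q(a,b)=\{(q^{k_1}a_1,\dots,q^{k_m}a_m,q^{\ell_1}b_1,\dots,q^{\ell_m}b_m):k,\ell\in\mathbb Z^m\}\subset\mathbb C^{2m}$, where $a,b\in\mathbb C^m$ have nonzero coordinates; the first $m$ entries are the $z$-coordinates and the last $m$ the $w$-coordinates.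 *)

(* Defs.v *)
From HB Require Import structures.
From mathcomp Require Import all_boot all_order all_fingroup all_algebra.
From mathcomp Require Import spectral complex.
From mathcomp Require Import all_classical all_reals.

Set Implicit Arguments.
Unset Strict Implicit.
Unset Printing Implicit Defensive.

Import Order.TTheory GRing.Theory Num.Theory.
Local Open Scope classical_set_scope.
Local Open Scope ring_scope.
Local Open Scope complex_scope.

Section Matrices.
Variables (R : realType) (m : nat).
Local Notation C := R[i].
Implicit Types (L M : 'M[C]_m) (G H K S : set 'M[C]_m).

(* Subgroups of GL_m(C), as sets of matrices. *)
Definition is_subgroup G : Prop :=
  [/\ G `<=` [set M | M \in unitmx],
      G 1%:M,
      forall L M, G L -> G M -> G (L *m M) &
      forall M, G M -> G (invmx M)].

Definition generated_subgroup S : set 'M[C]_m := smallest is_subgroup S.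

Definition conjugate_by L M : 'M[C]_m := L *m M *m invmx L.

Definition normalizes H G : Prop :=
  forall L, H L -> conjugate_by L @` G = G.

(* G is the internal semidirect product K ><| H, with K the normal factor. *)
Definition is_semidirect_product K H G : Prop :=
  [/\ is_subgroup K /\ is_subgroup H, is_subgroup G,
      normalizes H K,
      K `&` H = [set 1%:M] &
      G = [set D *m P | D in K & P in H]].

Definition coord_dilation (q : R) (i : 'I_m) : 'M[C]_m :=
  diag_mx (\row_j (if j == i then q%:C else 1)).

Definition coord_dilations (q : R) : set 'M[C]_m := range (coord_dilation q).

Definition dilation_group (q : R) : set 'M[C]_m :=
  generated_subgroup (coord_dilations q).

Definition is_monomial L : Prop :=
  exists D P : 'M[C]_m,
    [/\ is_diag_mx D, D \in unitmx, is_perm_mx P & L = D *m P].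

Definition unitary_group : set 'M[C]_m := [set U | U \is unitarymx].

Definition unitary_torus : set 'M[C]_m :=
  [set D | is_diag_mx D /\ D \is unitarymx].

Definition permutation_matrices : set 'M[C]_m := [set P | is_perm_mx P].

Definition torus_by_permutations : set 'M[C]_m :=
  [set D *m P | D in unitary_torus & P in permutation_matrices].

(* "Maximal" as a largest element: H contains every unitary subgroup that
   normalizes G. *)
Definition is_maximal_unitary_normalizer G H : Prop :=
  [/\ is_subgroup H, H `<=` unitary_group, normalizes H G &
      forall K, is_subgroup K -> K `<=` unitary_group -> normalizes K G ->
        K `<=` H].

Definition nonzero_coords (a : 'cV[C]_m) : Prop := forall i, a i 0 != 0.

Definition paired_grid (q : R) (a b : 'cV[C]_m) : set 'cV[C]_(m + m) :=
  [set x | exists k l : 'I_m -> int,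
     x = col_mx (\col_i (q%:C ^ k i * a i 0)) (\col_i (q%:C ^ l i * b i 0))].

Definition conj_mx n p (A : 'M[C]_(n, p)) : 'M[C]_(n, p) := map_mx Num.conj A.

(* (z, w) |-> (L z, conj(L) w) on C^(2m), with z the first m coordinates. *)
Definition paired_act L (x : 'cV[C]_(m + m)) : 'cV[C]_(m + m) :=
  col_mx (L *m usubmx x) (conj_mx L *m dsubmx x).

(* The bilinear form sum_i z_i w_i, which is the polarization of the
   Hermitian form sum_i |z_i|^2 (recovered on w = conj(z)). *)
Definition paired_form (x : 'cV[C]_(m + m)) : C :=
  \sum_i usubmx x i 0 * dsubmx x i 0.

End Matrices.

Arguments unitary_group R m : clear implicits.
Arguments unitary_torus R m : clear implicits.
Arguments permutation_matrices R m : clear implicits.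
Arguments torus_by_permutations R m : clear implicits.
Arguments coord_dilations {R} m q.
Arguments dilation_group {R} m q.

(* Main.v *)
Require Import Defs.
From HB Require Import structures.
From mathcomp Require Import all_boot all_order all_fingroup all_algebra.
From mathcomp Require Import spectral complex.
From mathcomp Require Import all_classical all_reals.
From mathcomp Require Import ring.

Set Implicit Arguments.
Unset Strict Implicit.
Unset Printing Implicit Defensive.

(** If [L T_b = diag (q ^ k) L], then at a nonzero entry [L a b'] the integer
    [k a] satisfies [q ^ k a = q] when [b' = b] and [q ^ k a = 1] otherwise.
    Two nonzero entries in row [a], in columns [b] and [b'], would thus give
    [q = 1].  Hence an invertible [L] that conjugates every [T_b] into the
    lattice [{diag (q ^ k)}] has a single nonzero entry in each row, and is
    monomial.  This settles both (i) -> (iii) and (ii) -> (iii); conversely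
    a monomial [L] with permutation [s] sends [diag e] to [diag (e \o s)]. *)

Import Order.TTheory GRing.Theory Num.Theory.
Local Open Scope classical_set_scope.
Local Open Scope ring_scope.
Local Open Scope complex_scope.

(** * Monomial matrices over a field *)

Section MonomialMatrices.
Variables (F : fieldType) (m : nat).
Implicit Types (d e : 'rV[F]_m) (s t : 'S_m) (A B : 'M[F]_m).

Lemma invmxE A B : A *m B = 1%:M -> invmx A = B.
Proof.
move=> AB1; have [Au _] := mulmx1_unit AB1.
by rewrite -[RHS](mulKmx Au) AB1 mulmx1.
Qed.

Definition monomial_mx d s : 'M[F]_m := diag_mx d *m perm_mx s.

Lemma monomial_mxE d s i j : monomial_mx d s i j = d 0 i *+ (s i == j).
Proof.
by rewrite /monomial_mx mul_diag_mx mxE /perm_mx !mxE mulr_natr.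
Qed.

Lemma mul_monomial_mx n d s (M : 'M[F]_(m, n)) i j :
  (monomial_mx d s *m M) i j = d 0 i * M (s i) j.
Proof. by rewrite /monomial_mx -mulmxA -row_permE mul_diag_mx !mxE. Qed.

(** Diagonal matrices commute with the factor [diag_mx d], so only the permutation acts on the
    entries of [e]. *)
Lemma mul_monomial_diag_mx d s e :
  monomial_mx d s *m diag_mx e = diag_mx (\row_i e 0 (s i)) *m monomial_mx d s.
Proof.
apply/matrixP => i j.
by rewrite mul_monomial_mx mulmxA mulmx_diag monomial_mxE !mxE mulrC mulrnAl.
Qed.

Lemma monomial_mxM d e s t :
  monomial_mx d s *m monomial_mx e t =
  monomial_mx (\row_i (d 0 i * e 0 (s i))) (s * t).
Proof.
apply/matrixP => i j.
by rewrite mul_monomial_mx !monomial_mxE mxE permM mulrnAr.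
Qed.

Lemma monomial_mx_row d s i j j' :
  monomial_mx d s i j != 0 -> monomial_mx d s i j' != 0 -> j = j'.
Proof.
rewrite !monomial_mxE; case: (s i =P j) => [<- _|_]; last by rewrite eqxx.
by case: (s i =P j') => // _; rewrite eqxx.
Qed.

Lemma diag_mx_unit d : (diag_mx d \in unitmx) = [forall i, d 0 i != 0].
Proof.
rewrite unitmxE det_diag unitfE.
by apply/prodf_neq0/forallP => d0 i; rewrite d0.
Qed.

(** An invertible matrix has no zero row and no zero column. The column [s i] of the nonzero entry
    in row [i] thus takes every value, and a surjection of a finite set onto itself is a
    permutation. *)
Lemma single_entry_rows_monomial A :
  A \in unitmx ->
  (forall i j j', A i j != 0 -> A i j' != 0 -> j = j') ->
  exists d s, A = monomial_mx d s.
Proof.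
move=> Au row1.
have ex_row i : exists j, A i j != 0.
  case: (pickP (fun j => A i j != 0)) => [j|Ai0]; first by exists j.
  have : (A *m invmx A) i i = 0.
    by rewrite mxE big1 // => j _; rewrite (eqP (negbFE (Ai0 j))) mul0r.
  by rewrite mulmxV // mxE eqxx => /eqP; rewrite oner_eq0.
have ex_col j : exists i, A i j != 0.
  case: (pickP (fun i => A i j != 0)) => [i|Aj0]; first by exists i.
  have : (invmx A *m A) j j = 0.
    by rewrite mxE big1 // => i _; rewrite (eqP (negbFE (Aj0 i))) mulr0.
  by rewrite mulVmx // mxE eqxx => /eqP; rewrite oner_eq0.
pose s i := xchoose (ex_row i).
pose t j := xchoose (ex_col j).
(* Row [t j] has nonzero entries in columns [s (t j)] and [j], which must coincide. *)
have tK : cancel t s.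
  by move=> j; exact: row1 (xchooseP (ex_row _)) (xchooseP (ex_col j)).
have sI : injective s := can_inj (canF_sym tK).
exists (\row_i A i (s i)), (perm sI).
apply/matrixP => i j; rewrite monomial_mxE mxE permE.
case: eqP => [<- //|sij]; apply/eqP; case: eqP => // /eqP Aij.
by case: sij; exact: row1 (xchooseP (ex_row i)) Aij.
Qed.

End MonomialMatrices.

(** * The dilation group and its normalizing matrices *)

Section Dilations.
Variables (R : realType) (m : nat).
Local Notation C := R[i].

Lemma is_monomialP (L : 'M[C]_m) :
  is_monomial L <->
  exists (d : 'rV_m) (s : 'S_m), (forall i, d 0 i != 0) /\ L = monomial_mx d s.
Proof.
split=> [[D [P [/diag_mxP[d ->]]]]|[d [s [d0 ->]]]].
  rewrite diag_mx_unit => /forallP d0 /is_perm_mxP[s ->] ->.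
  by exists d, s.
exists (diag_mx d), (perm_mx s).
split; rewrite ?diag_mx_is_diag ?perm_mx_is_perm ?diag_mx_unit //.
exact/forallP.
Qed.

Lemma conjugate_by_inj (L : 'M[C]_m) :
  L \in unitmx -> injective (conjugate_by L).
Proof.
move=> Lu A B /(congr1 (fun X => invmx L *m (X *m L))).
by rewrite /conjugate_by !mulmxKV // !mulKmx.
Qed.

Lemma conjugate_byE (L A B : 'M[C]_m) :
  L \in unitmx -> L *m A = B *m L -> conjugate_by L A = B.
Proof. by move=> Lu LA; rewrite /conjugate_by LA mulmxK. Qed.

Lemma conjugate_by_monomial (L : 'M[C]_m) d s e :
  L \in unitmx -> L = monomial_mx d s ->
  conjugate_by L (diag_mx e) = diag_mx (\row_i e 0 (s i)).
Proof.
move=> Lu defL; apply: conjugate_byE => //.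
by rewrite defL mul_monomial_diag_mx.
Qed.

Variable q : R.
Hypothesis hq : 0 < q < 1.

Definition lattice_dilation (k : 'I_m -> int) : 'M[C]_m :=
  diag_mx (\row_j q%:C ^ k j).

Let qC_neq0 : q%:C != 0.
Proof. by case/andP: hq => q0 _; rewrite gt_eqF // ltcR. Qed.

Let qC_neq1 : q%:C != 1.
Proof. by case/andP: hq => _ q1; rewrite lt_eqF // ltcR. Qed.

Lemma coord_dilationE i :
  coord_dilation q i = lattice_dilation (fun j => (j == i)%:R).
Proof.
rewrite /coord_dilation; congr diag_mx.
by apply/rowP => j; rewrite !mxE; case: eqP.
Qed.

Lemma lattice_dilationM k l :
  lattice_dilation k *m lattice_dilation l =
  lattice_dilation (fun j => k j + l j).
Proof.
by rewrite mulmx_diag; congr diag_mx; apply/rowP => j; rewrite !mxE expfzDr.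
Qed.

Lemma lattice_dilation0 : lattice_dilation (fun=> 0) = 1%:M.
Proof.
by rewrite -diag_const_mx; congr diag_mx; apply/rowP => j; rewrite !mxE.
Qed.

Lemma lattice_dilation_unit k : lattice_dilation k \in unitmx.
Proof.
by rewrite diag_mx_unit; apply/forallP => j; rewrite mxE expfz_neq0.
Qed.

Lemma invmx_lattice_dilation k :
  invmx (lattice_dilation k) = lattice_dilation (fun j => - k j).
Proof.
rewrite -[RHS](mulKmx (lattice_dilation_unit k)) lattice_dilationM.
rewrite (_ : (fun j => _) = (fun=> 0)) ?lattice_dilation0 ?mulmx1 //.
by apply/funext => j; rewrite subrr.
Qed.

Lemma lattice_is_subgroup : is_subgroup (range lattice_dilation).
Proof.
split.
- by move=> _ [k _ <-]; exact: lattice_dilation_unit.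
- by exists (fun=> 0) => //; exact: lattice_dilation0.
- move=> _ _ [k _ <-] [l _ <-]; exists (fun j => k j + l j) => //.
  by rewrite lattice_dilationM.
- move=> _ [k _ <-]; exists (fun j => - k j) => //.
  by rewrite invmx_lattice_dilation.
Qed.

(** The range is a subgroup containing the generators. Conversely, [diag (q ^ k)] is the product of
    the powers [T_i ^ k i], which lie in every subgroup containing the generators. *)
Lemma dilation_groupE : dilation_group m q = range lattice_dilation.
Proof.
rewrite eqEsubset; split.
  apply: smallest_sub; first exact: lattice_is_subgroup.
  by move=> _ [i _ <-]; exists (fun j => (j == i)%:R); rewrite // coord_dilationE.
move=> _ [k _ <-] H [[_ H1 HM HV] HT].
(* This is [T_i ^ n] in exponent form; negative powers follow by closure under inverses. *)
have Hnat i (n : nat) : H (lattice_dilation (fun j => (j == i)%:R * n%:Z)).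
  elim: n => [|n IHn].
    rewrite (_ : (fun j => _) = (fun=> 0)) ?lattice_dilation0 //.
    by apply/funext => j; rewrite mulr0.
  rewrite (_ : (fun j => _) =
      fun j => (j == i)%:R + (j == i)%:R * n%:Z); last first.
    by apply/funext => j; rewrite intS mulrDr mulr1.
  rewrite -lattice_dilationM; apply: HM => //; apply: HT.
  by exists i; rewrite // coord_dilationE.
have Hint i (n : int) : H (lattice_dilation (fun j => (j == i)%:R * n)).
  case: n => n; first exact: Hnat.
  rewrite (_ : (fun j => _) = fun j => - ((j == i)%:R * n.+1%:Z)); last first.
    by apply/funext => j; rewrite NegzE mulrN.
  by rewrite -invmx_lattice_dilation; exact/HV/Hnat.
(* Expanding [k] in the standard basis over an explicit list lets an induction on an arbitrary list
   build the product factor by factor. *)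
have -> : k = fun j => \sum_(i <- enum 'I_m) (j == i)%:R * k i.
  apply/funext => j; rewrite big_enum (bigD1 j) //= eqxx mul1r big1 ?addr0 //.
  by move=> i /negPf; rewrite eq_sym => ->; rewrite mul0r.
elim: (enum _) => [|i r IHr].
  rewrite (_ : (fun j => _) = (fun=> 0)) ?lattice_dilation0 //.
  by apply/funext => j; rewrite big_nil.
rewrite (_ : (fun j => _) = fun j => (j == i)%:R * k i +
    \sum_(i <- r) (j == i)%:R * k i); last first.
  by apply/funext => j; rewrite big_cons.
by rewrite -lattice_dilationM; exact: HM.
Qed.

Lemma conjugate_coord_dilations_monomial (L : 'M[C]_m) :
  L \in unitmx ->
  (forall i, range lattice_dilation (conjugate_by L (coord_dilation q i))) ->
  is_monomial L.
Proof.
move=> Lu LT.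
have row1 i j j' : L i j != 0 -> L i j' != 0 -> j = j'.
  move=> Lij Lij'; apply/eqP/negPn/negP => jj'.
  have [k _ defT] := LT j.
  have eqLT : lattice_dilation k *m L = L *m coord_dilation q j.
    by rewrite defT /conjugate_by mulmxKV.
  (* Compare the entries [(i, b)] of both sides of [eqLT] and cancel [L i b]. *)
  have eqk b : L i b != 0 -> q%:C ^ k i = if b == j then q%:C else 1.
    move=> Lib; apply: (mulIf Lib); move/matrixP/(_ i b): eqLT.
    by rewrite mul_mx_diag mul_diag_mx !mxE [RHS]mulrC.
  move: (eqk j Lij); rewrite (eqk j' Lij') eqxx eq_sym (negPf jj') => /esym/eqP.
  by rewrite (negPf qC_neq1).
have [d [s defL]] := single_entry_rows_monomial Lu row1.
(* A vanishing [d 0 i] would make row [i] of [L] zero, contradicting invertibility. *)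
apply/is_monomialP; exists d, s; split=> // i; apply/negP => /eqP di0.
have : (L *m invmx L) i i = 0 by rewrite defL mul_monomial_mx di0 mul0r.
by rewrite mulmxV // mxE eqxx => /eqP; rewrite oner_eq0.
Qed.

(** Conjugation sends [T_(s i)] to [T_i], because [s j = s i] only for [j = i]. *)
Lemma monomial_permutes_coord_dilations (L : 'M[C]_m) :
  L \in unitmx -> is_monomial L ->
  set_bij (coord_dilations m q) (coord_dilations m q) (conjugate_by L).
Proof.
move=> Lu /is_monomialP[d [s [_ defL]]].
have conjT i : conjugate_by L (coord_dilation q (s i)) = coord_dilation q i.
  rewrite (conjugate_by_monomial _ Lu defL); congr diag_mx.
  by apply/rowP => j; rewrite !mxE (inj_eq perm_inj).
split.
- move=> _ [i _ <-]; exists ((s^-1)%g i) => //.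
  by rewrite -conjT permKV.
- by move=> A B _ _; exact: conjugate_by_inj.
- by move=> _ [i _ <-]; exists (coord_dilation q (s i)) => //; exists (s i).
Qed.

(** On exponents, conjugation is [k |-> k \o s], with inverse [k |-> k \o s^-1]. *)
Lemma monomial_normalizes_dilation_group (L : 'M[C]_m) :
  L \in unitmx -> is_monomial L ->
  conjugate_by L @` dilation_group m q = dilation_group m q.
Proof.
move=> Lu /is_monomialP[d [s [_ defL]]]; rewrite dilation_groupE.
have conjT k : conjugate_by L (lattice_dilation k) = lattice_dilation (k \o s).
  rewrite (conjugate_by_monomial _ Lu defL); congr diag_mx.
  by apply/rowP => j; rewrite !mxE.
rewrite eqEsubset; split.
  by move=> _ [_ [k _ <-] <-]; exists (k \o s).
move=> _ [k _ <-]; exists (lattice_dilation (k \o (s^-1)%g)).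
  by exists (k \o (s^-1)%g).
by rewrite conjT; congr lattice_dilation; apply/funext => j /=; rewrite permK.
Qed.

Lemma normalizes_dilation_group_monomial (L : 'M[C]_m) :
  L \in unitmx ->
  conjugate_by L @` dilation_group m q = dilation_group m q -> is_monomial L.
Proof.
move=> Lu LG; apply: conjugate_coord_dilations_monomial => // i.
rewrite -dilation_groupE -LG; exists (coord_dilation q i) => //.
by apply: sub_gen_smallest; exists i.
Qed.

Lemma permutes_coord_dilations_monomial (L : 'M[C]_m) :
  L \in unitmx ->
  set_bij (coord_dilations m q) (coord_dilations m q) (conjugate_by L) ->
  is_monomial L.
Proof.
move=> Lu [LT _ _]; apply: conjugate_coord_dilations_monomial => // i.
have /LT : coord_dilations m q (coord_dilation q i) by exists i.
by rewrite -dilation_groupE; exact: sub_gen_smallest.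
Qed.

End Dilations.

(** * Unitary monomial matrices: semidirect product and maximality *)

Section UnitaryGroups.
Variables (R : realType) (m : nat).
Local Notation C := R[i].
Implicit Types (L : 'M[C]_m) (G H K : set 'M[C]_m).

Lemma is_subgroupI G H : is_subgroup G -> is_subgroup H -> is_subgroup (G `&` H).
Proof.
move=> [Gu G1 GM GV] [_ H1 HM HV]; split=> //.
- by move=> L [/Gu].
- by move=> L M [GL HL] [GM' HM']; split; [exact: GM|exact: HM].
- by move=> L [/GV GL /HV HL].
Qed.

(** The inclusion for [L^-1] gives the reverse inclusion for [L]: any [A] in [K] is the conjugate by
    [L] of [L^-1 A L]. *)
Lemma sub_normalizes H K :
  is_subgroup H -> (forall L, H L -> conjugate_by L @` K `<=` K) ->
  normalizes H K.
Proof.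
move=> [Hu _ _ HV] HK L HL; have Lu : L \in unitmx := Hu _ HL.
rewrite eqEsubset; split; first exact: HK.
move=> A KA; exists (conjugate_by (invmx L) A).
  by apply: (HK _ (HV _ HL)); exists A.
apply: conjugate_byE => //.
by rewrite /conjugate_by invmxK !mulmxA mulmxV // mul1mx.
Qed.

Lemma unitary_group_is_subgroup : is_subgroup (unitary_group R m).
Proof.
rewrite /unitary_group; split=> /=.
- by move=> L; exact: unitarymx_unit.
- by apply/unitarymxP; rewrite trmx1 map_mx1 mulmx1.
- by move=> L M; exact: mul_unitarymx.
- by move=> L Lu; rewrite invmx_unitary ?trmxC_unitary.
Qed.

Lemma diagonal_is_subgroup :
  is_subgroup [set D : 'M[C]_m | is_diag_mx D /\ D \in unitmx].
Proof.
split=> /=.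
- by move=> L [].
- by rewrite scalar_mx_is_diag unitmx1.
- move=> _ _ [/diag_mxP[d ->] du] [/diag_mxP[e ->] eu].
  by rewrite unitmx_mul du eu mulmx_diag diag_mx_is_diag.
- move=> _ [/diag_mxP[d ->] du]; rewrite unitmx_inv; split=> //.
  move: du; rewrite diag_mx_unit => /forallP d0.
  rewrite (@invmxE _ _ _ (diag_mx (\row_i (d 0 i)^-1))) ?diag_mx_is_diag //.
  rewrite mulmx_diag -diag_const_mx; congr diag_mx.
  by apply/rowP => i; rewrite !mxE divff.
Qed.

Lemma monomial_is_subgroup :
  is_subgroup [set L : 'M[C]_m | is_monomial L].
Proof.
split=> /=.
- move=> _ [D [P [_ Du /is_perm_mxP[s ->] ->]]].
  by rewrite /= unitmx_mul Du unitmx_perm.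
- exists 1%:M, 1%:M; rewrite scalar_mx_is_diag unitmx1 mulmx1.
  by split=> //; rewrite -perm_mx1 perm_mx_is_perm.
- move=> _ _ /is_monomialP[d [s [d0 ->]]] /is_monomialP[e [t [e0 ->]]].
  rewrite monomial_mxM; apply/is_monomialP; do 2 eexists; split; last by [].
  by move=> i; rewrite mxE mulf_neq0.
- move=> _ /is_monomialP[d [s [d0 ->]]]; apply/is_monomialP.
  (* By [monomial_mxM] the inverse needs coefficients [e] with [d 0 i * e 0 (s i) = 1] for all
     [i]. *)
  exists (\row_i (d 0 ((s^-1)%g i))^-1), (s^-1)%g; split.
    by move=> i; rewrite mxE invr_neq0.
  apply: invmxE; rewrite monomial_mxM mulgV /monomial_mx perm_mx1 mulmx1.
  rewrite -diag_const_mx; congr diag_mx.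
  by apply/rowP => i; rewrite !mxE permK divff.
Qed.

Lemma permutation_matrices_is_subgroup : is_subgroup (permutation_matrices R m).
Proof.
rewrite /permutation_matrices; split=> /=.
- by move=> _ /is_perm_mxP[s ->]; exact: unitmx_perm.
- by rewrite -perm_mx1 perm_mx_is_perm.
- move=> _ _ /is_perm_mxP[s ->] /is_perm_mxP[t ->].
  by rewrite -perm_mxM perm_mx_is_perm.
- move=> _ /is_perm_mxP[s ->].
  rewrite (@invmxE _ _ _ (perm_mx s^-1)) ?perm_mx_is_perm //.
  by rewrite -perm_mxM mulgV perm_mx1.
Qed.

Lemma perm_mx_unitary (s : 'S_m) : (perm_mx s : 'M[C]_m) \is unitarymx.
Proof.
by apply/unitarymxP; rewrite tr_perm_mx map_perm_mx -perm_mxM mulgV perm_mx1.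
Qed.

Lemma unitary_torusE :
  unitary_torus R m =
  [set D | is_diag_mx D /\ D \in unitmx] `&` unitary_group R m.
Proof.
rewrite eqEsubset; split=> [D [Dd Du]|D [[Dd _] Du]] //.
by do !split=> //; exact: unitarymx_unit.
Qed.

(** Permutation matrices are unitary, so [D *m P] is unitary exactly when [D] is. The intersection
    form yields both the subgroup property and the maximality. *)
Lemma torus_by_permutationsE :
  torus_by_permutations R m = [set L | is_monomial L] `&` unitary_group R m.
Proof.
rewrite eqEsubset; split.
  move=> _ [D [Dd Du] [P Pp <-]]; split.
    by exists D, P; split=> //; exact: unitarymx_unit.
  case/is_perm_mxP: Pp => s ->.
  by rewrite /unitary_group /= mul_unitarymx ?perm_mx_unitary.
move=> _ [[D [P [Dd Du Pp ->]]] /= DPu]; exists D; last by exists P.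
split=> //; case/is_perm_mxP: Pp DPu => s -> DPu.
(* [D] is recovered as the product of the unitary matrices [D *m P] and [invmx P]. *)
rewrite -(mulmxK (unitmx_perm _ s) D) mul_unitarymx //.
by case: unitary_group_is_subgroup => _ _ _; apply; exact: perm_mx_unitary.
Qed.

Lemma torus_by_permutations_is_subgroup :
  is_subgroup (torus_by_permutations R m).
Proof.
rewrite torus_by_permutationsE.
exact: is_subgroupI monomial_is_subgroup unitary_group_is_subgroup.
Qed.

Lemma torus_by_permutations_semidirect :
  is_semidirect_product (unitary_torus R m) (permutation_matrices R m)
    (torus_by_permutations R m).
Proof.
have torus_group : is_subgroup (unitary_torus R m).
  rewrite unitary_torusE.
  exact: is_subgroupI diagonal_is_subgroup unitary_group_is_subgroup.
split=> //.
- by split=> //; exact: permutation_matrices_is_subgroup.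
- exact: torus_by_permutations_is_subgroup.
- apply: sub_normalizes; first exact: permutation_matrices_is_subgroup.
  move=> _ /is_perm_mxP[s ->] _ [_ [/diag_mxP[d ->] du] <-].
  (* Unit coefficients turn the permutation matrix into a monomial one, so that its conjugates of
     diagonal matrices are known to be diagonal. *)
  have permE1 : perm_mx s = monomial_mx (const_mx 1) s :> 'M[C]_m.
    by rewrite /monomial_mx diag_const_mx mul1mx.
  split.
    rewrite (conjugate_by_monomial _ (unitmx_perm _ s) permE1).
    exact: diag_mx_is_diag.
  rewrite !mul_unitarymx ?perm_mx_unitary //.
  by case: unitary_group_is_subgroup => _ _ _; apply; exact: perm_mx_unitary.
- rewrite eqEsubset; split=> [P [[/is_diag_mxP sd _] /is_perm_mxP[s defP]]|_ ->].
    (* The entry [(i, s i)] equals 1, so in a diagonal permutation matrix every [i] is fixed by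
       [s]. *)
    move: sd; rewrite defP => sd; suff -> : s = 1%g by rewrite perm_mx1.
    apply/permP => i; rewrite perm1; apply/eqP; case: eqP => // /eqP si.
    have /eqP : (perm_mx s : 'M[C]_m) i (s i) = 0 by apply: sd; rewrite eq_sym.
    by rewrite !mxE eqxx oner_eq0.
  have [_ T1 _ _] := torus_group.
  by have [_ P1 _ _] := permutation_matrices_is_subgroup.
Qed.

(** Every single element of a unitary subgroup normalizing the dilation group is monomial, so the
    group of all unitary monomial matrices is the largest one. *)
Lemma torus_by_permutations_maximal (q : R) : 0 < q < 1 ->
  is_maximal_unitary_normalizer (dilation_group m q) (torus_by_permutations R m).
Proof.
move=> hq; split.
- exact: torus_by_permutations_is_subgroup.
- by rewrite torus_by_permutationsE => L [].
- rewrite torus_by_permutationsE => L [mL uL].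
  by apply: monomial_normalizes_dilation_group => //; exact: unitarymx_unit.
- move=> K _ KU KG L KL; rewrite torus_by_permutationsE; split; last exact: KU.
  apply: (normalizes_dilation_group_monomial hq (unitarymx_unit (KU _ KL))).
  exact: KG.
Qed.

End UnitaryGroups.

(* The witness is the reflection in the hyperplane orthogonal to (1, 2, 0, ...). *)
Lemma unitary_not_monomial (R : realType) m :
  exists2 U : 'M[R[i]]_m.+2, U \is unitarymx & ~ is_monomial U.
Proof.
(* The default value 0 of [nth] fills all coordinates after the first two. *)
pose v : 'cV[R[i]]_m.+2 := \col_i (nth 0 [:: 1; 2]%N i)%:R.
have vv : v^T *m v = 5%:R%:M.
  apply/matrixP => i j; rewrite !ord1 !mxE eqxx mulr1n big_ord_recl big_ord_recl.
  rewrite big1 => [|k _]; last by rewrite !mxE /= nth_nil mul0r.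
  by rewrite !mxE /= addr0 -!natrM -natrD.
(* The reflection coefficient is 2 divided by the squared norm 5 of [v]. *)
pose a : R[i] := 2 / 5.
pose U : 'M[R[i]]_m.+2 := 1%:M - a *: (v *m v^T).
exists U.
  have UT : map_mx Num.conj U^T = U.
    have va : map_mx Num.conj v = v.
      by apply/colP => i; rewrite !mxE rmorph_nat.
    rewrite /U linearB linearZ /= trmx1 trmx_mul trmxK map_mxB map_mx1 map_mxZ.
    by rewrite map_mxM -map_trmx va /a fmorph_div !rmorph_nat.
  (* [U] is its own adjoint, so unitarity means [U *m U = 1%:M], which comes down to
     [2 a = 5 a ^ 2]. *)
  apply/unitarymxP; rewrite UT /U mulmxBl mul1mx mulmxBr mulmx1.
  rewrite -scalemxAl -scalemxAr mulmxA -(mulmxA v) vv mul_mx_scalar -scalemxAl.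
  rewrite !scalerA -scalerBl -addrA -opprD -scalerDl.
  rewrite (_ : a + _ = 0) ?scale0r ?subr0 // /a.
  by field.
move=> /is_monomialP[d [s [_ Us]]].
have UE (i j : 'I_m.+2) : U i j = (i == j)%:R -
    a * ((nth 0 [:: 1; 2] i)%:R * (nth 0 [:: 1; 2] j)%:R).
  by rewrite !mxE big_ord1 !mxE.
(* Row 0 starts with 3/5 and -4/5: two nonzero entries, impossible for a monomial matrix. *)
have U00 : U 0 0 != 0.
  rewrite UE; have -> : 1%:R - a * (1%:R * 1%:R) = 3 / 5 by rewrite /a; field.
  by rewrite mulf_neq0 ?invr_neq0 ?pnatr_eq0.
have U01 : U 0 1 != 0.
  rewrite UE sub0r oppr_eq0.
  by rewrite !mulf_neq0 ?invr_neq0 ?pnatr_eq0.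
by rewrite Us in U00 U01; have := monomial_mx_row U00 U01.
Qed.

(** * The paired action on the grid and the polarized Hermitian form *)

Section PairedAction.
Variables (R : realType) (m : nat).
Local Notation C := R[i].

Lemma paired_act1 (x : 'cV[C]_(m + m)) : paired_act 1%:M x = x.
Proof. by rewrite /paired_act /conj_mx map_mx1 !mul1mx vsubmxK. Qed.

Lemma paired_actM (L M : 'M[C]_m) x :
  paired_act (L *m M) x = paired_act L (paired_act M x).
Proof.
by rewrite /paired_act /conj_mx map_mxM col_mxKu col_mxKd !mulmxA.
Qed.

Lemma conj_monomial_mx (d : 'rV[C]_m) s :
  conj_mx (monomial_mx d s) = monomial_mx (conj_mx d) s.
Proof.
by rewrite /monomial_mx /conj_mx map_mxM map_diag_mx map_perm_mx.
Qed.

Lemma monomial_nonzero_coords (L : 'M[C]_m) a :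
  is_monomial L -> nonzero_coords a -> nonzero_coords (L *m a).
Proof.
move=> /is_monomialP[d [s [d0 ->]]] a0 i.
by rewrite mul_monomial_mx mulf_neq0.
Qed.

Lemma conj_mx_monomial (L : 'M[C]_m) : is_monomial L -> is_monomial (conj_mx L).
Proof.
move=> /is_monomialP[d [s [d0 ->]]]; apply/is_monomialP.
exists (conj_mx d), s; rewrite conj_monomial_mx; split=> // i.
by rewrite mxE fmorph_eq0.
Qed.

(** The coefficients [d] commute with the powers of [q] and move only the base point, while [s] also
    reindexes the exponents; hence a grid goes to a grid. *)
Lemma monomial_mx_grid (d : 'rV[C]_m) s (q : R) (a : 'cV[C]_m) k :
  monomial_mx d s *m (\col_i (q%:C ^ k i * a i 0)) =
  \col_i (q%:C ^ (k (s i)) * (monomial_mx d s *m a) i 0).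
Proof.
by apply/colP => i; rewrite [RHS]mxE !mul_monomial_mx mxE mulrCA.
Qed.

(** Conjugating [L] keeps its permutation, so both exponent vectors are reindexed by the same [s],
    and reindexing by [s^-1] supplies preimages. *)
Lemma paired_act_grid (L : 'M[C]_m) (q : R) a b :
  is_monomial L ->
  paired_act L @` paired_grid q a b = paired_grid q (L *m a) (conj_mx L *m b).
Proof.
move=> /is_monomialP[d [s [d0 ->]]]; rewrite conj_monomial_mx.
have actE k l : paired_act (monomial_mx d s)
    (col_mx (\col_i (q%:C ^ k i * a i 0)) (\col_i (q%:C ^ l i * b i 0))) =
  col_mx (\col_i (q%:C ^ (k (s i)) * (monomial_mx d s *m a) i 0))
    (\col_i (q%:C ^ (l (s i)) * (monomial_mx (conj_mx d) s *m b) i 0)).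
  by rewrite /paired_act col_mxKu col_mxKd conj_monomial_mx !monomial_mx_grid.
rewrite eqEsubset; split.
  by move=> _ [_ [k [l ->]] <-]; exists (k \o s), (l \o s); rewrite actE.
move=> _ [k [l ->]].
exists (col_mx (\col_i (q%:C ^ (k ((s^-1)%g i)) * a i 0))
               (\col_i (q%:C ^ (l ((s^-1)%g i)) * b i 0))).
  by exists (k \o (s^-1)%g), (l \o (s^-1)%g).
rewrite (actE (k \o (s^-1)%g) (l \o (s^-1)%g)).
by congr col_mx; apply/colP => i; rewrite [LHS]mxE [RHS]mxE /= permK.
Qed.

(** The real slice [w = conj z] is preserved, and the action restricts there to [z |-> L z]. *)
Lemma paired_act_conj (L : 'M[C]_m) (z : 'cV[C]_m) :
  paired_act L (col_mx z (conj_mx z)) = col_mx (L *m z) (conj_mx (L *m z)).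
Proof. by rewrite /paired_act col_mxKu col_mxKd /conj_mx map_mxM. Qed.

Lemma paired_formE (x : 'cV[C]_(m + m)) :
  paired_form x = ((usubmx x)^T *m dsubmx x) 0 0.
Proof. by rewrite mxE; apply: eq_bigr => i _; rewrite [in RHS]mxE. Qed.

(** The action inserts [L^T *m conj_mx L] into the form; this is the identity because [L^T] is
    unitary as well. *)
Lemma paired_form_unitary (L : 'M[C]_m) x :
  L \is unitarymx -> paired_form (paired_act L x) = paired_form x.
Proof.
move=> Lu; rewrite !paired_formE /paired_act col_mxKu col_mxKd trmx_mul.
rewrite !mulmxA -(mulmxA _ L^T).
have -> : L^T *m conj_mx L = 1%:M.
  by move: Lu; rewrite -trmx_unitary => /unitarymxP; rewrite trmxK.
by rewrite mulmx1.
Qed.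

End PairedAction.

Theorem theorem3p8 (R : realType) (m : nat) (q : R) (hq : 0 < q < 1) :
  [/\ (forall L : 'M[R[i]]_m, L \in unitmx ->
         [<-> conjugate_by L @` dilation_group m q = dilation_group m q;
              set_bij (coord_dilations m q) (coord_dilations m q)
                (conjugate_by L);
              is_monomial L]),
      is_semidirect_product (unitary_torus R m) (permutation_matrices R m)
        (torus_by_permutations R m),
      is_maximal_unitary_normalizer (dilation_group m q)
        (torus_by_permutations R m),
      ((2 <= m)%N -> torus_by_permutations R m <> unitary_group R m) &
      [/\ (forall x : 'cV[R[i]]_(m + m), paired_act 1%:M x = x),
          (forall L M : 'M[R[i]]_m,
             is_monomial L -> L \is unitarymx ->
             is_monomial M -> M \is unitarymx ->
             forall x, paired_act (L *m M) x = paired_act L (paired_act M x)) &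
          forall L : 'M[R[i]]_m, is_monomial L -> L \is unitarymx ->
            [/\ (forall a b : 'cV[R[i]]_m, nonzero_coords a -> nonzero_coords b ->
                   [/\ nonzero_coords (L *m a), nonzero_coords (conj_mx L *m b) &
                       paired_act L @` paired_grid q a b =
                         paired_grid q (L *m a) (conj_mx L *m b)]),
                (forall z : 'cV[R[i]]_m,
                   paired_act L (col_mx z (conj_mx z)) =
                     col_mx (L *m z) (conj_mx (L *m z))) &
                forall x, paired_form (paired_act L x) = paired_form x]]].
Proof.
split.
- move=> L Lu; tfae.
  (* The implication (i) -> (ii) passes through (iii). *)
  + move=> LG; apply: monomial_permutes_coord_dilations => //.
    exact (normalizes_dilation_group_monomial hq Lu LG).
  + exact (permutes_coord_dilations_monomial hq Lu).
  + exact: monomial_normalizes_dilation_group.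
- exact: torus_by_permutations_semidirect.
- exact: torus_by_permutations_maximal.
(* For [m = n + 2], equality of the groups would make the non-monomial unitary reflection
   monomial. *)
- case: m => [|[|n]] // _ tU.
  have [U Uu nU] := unitary_not_monomial R n; apply: nU.
  have : unitary_group R n.+2 U by [].
  by rewrite -tU torus_by_permutationsE => -[].
- split; first exact: paired_act1.
    by move=> L M _ _ _ _ x; exact: paired_actM.
  move=> L mL uL; split.
  + move=> a b a0 b0; split.
    * exact: monomial_nonzero_coords.
    * exact/monomial_nonzero_coords/b0/conj_mx_monomial.
    * exact: paired_act_grid.
  + exact: paired_act_conj.
  + by move=> x; exact: paired_form_unitary.
Qed.
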